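(* Let $H=\mathrm{Homeo}_+([0,1])$ be the group of order-preserving homeomorphisms of $[0,1]$. Then every two-dimensional topological similarity class in $H$ is meager in $H\times H$.
   Context: $H$ carries the topology with basic open sets $U(f;a_1,\dots,a_n;\varepsilon)=\{g\in H: |g(a_i)-f(a_i)|<\varepsilon \text{ for } i=1,\dots,n\}$, for $f\in H$, $a_1,\dots,a_n\in[0,1]$, $\varepsilon>0$; this makes $H$ a Polish group. For a topological group $K$, a pair $(g_1,g_2)\in K^2$ is topologically similar to $(f_1,f_2)\in K^2$ if the map $g_i\mapsto f_i$ ($i=1,2$) extends to a group isomorphism $\langle g_1,g_2\rangle\to\langle f_1,f_2\rangle$ that is a homeomorphism with respect to the subspace topologies. Its equivalence classes are the two-dimensional topological similarity classes. *)

(* Defs.v *)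
From Stdlib Require Import Reals Lra List.
Open Scope R_scope.

(* Elements of H = Homeo_+([0,1]) are represented by functions R -> R that are
   the identity outside [0,1] (a normalization making Leibniz equality of
   functions coincide with equality of homeomorphisms of [0,1]). *)
Definition I01 (x : R) : Prop := 0 <= x <= 1.

Definition in_H (f : R -> R) : Prop :=
  (forall x, ~ I01 x -> f x = x) /\
  (forall x, I01 x -> I01 (f x)) /\
  (forall x y, I01 x -> I01 y -> f x = f y -> x = y) /\
  (forall y, I01 y -> exists x, I01 x /\ f x = y) /\
  (forall x, I01 x -> forall eps, 0 < eps -> exists delta, 0 < delta /\
     forall y, I01 y -> Rabs (y - x) < delta -> Rabs (f y - f x) < eps) /\
  (forall x, I01 x -> forall eps, 0 < eps -> exists delta, 0 < delta /\
     forall y, I01 y -> Rabs (f y - f x) < delta -> Rabs (y - x) < eps) /\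
  (forall x y, I01 x -> I01 y -> x <= y -> f x <= f y).

Definition HSet := (R -> R) -> Prop.

Definition basic (f : R -> R) (l : list R) (eps : R) : HSet :=
  fun g => in_H g /\ forall a, In a l -> Rabs (g a - f a) < eps.

Definition basic_ok (l : list R) (eps : R) : Prop :=
  (forall a, In a l -> I01 a) /\ 0 < eps.

Definition H_open (O : HSet) : Prop :=
  (forall f, O f -> in_H f) /\
  forall f, O f -> exists l eps, basic_ok l eps /\
    forall g, basic f l eps g -> O g.

Definition rel_open (G S : HSet) : Prop :=
  exists O, H_open O /\ forall x, G x -> (S x <-> O x).

Inductive gen (g1 g2 : R -> R) : HSet :=
| gen_id : gen g1 g2 (fun x => x)
| gen_g1 : gen g1 g2 g1
| gen_g2 : gen g1 g2 g2
| gen_comp : forall h k, gen g1 g2 h -> gen g1 g2 k -> gen g1 g2 (fun x => h (k x))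
| gen_inv : forall h k, gen g1 g2 h ->
    (forall x, k (h x) = x) -> (forall x, h (k x) = x) -> gen g1 g2 k.

Definition top_similar (g1 g2 f1 f2 : R -> R) : Prop :=
  exists phi : (R -> R) -> (R -> R),
    let G := gen g1 g2 in let F := gen f1 f2 in
    (forall x, G x -> F (phi x)) /\
    (forall x y, G x -> G y -> phi x = phi y -> x = y) /\
    (forall z, F z -> exists x, G x /\ phi x = z) /\
    (forall x y, G x -> G y -> phi (fun t => x (y t)) = (fun t => phi x (phi y t))) /\
    phi g1 = f1 /\ phi g2 = f2 /\
    (forall O, H_open O -> rel_open G (fun x => O (phi x))) /\
    (forall O, H_open O -> rel_open F (fun z => exists x, G x /\ O x /\ phi x = z)).

Definition H2Set := (R -> R) -> (R -> R) -> Prop.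

Definition H2_open (O : H2Set) : Prop :=
  (forall a b, O a b -> in_H a /\ in_H b) /\
  forall a b, O a b -> exists l1 e1 l2 e2, basic_ok l1 e1 /\ basic_ok l2 e2 /\
    forall c d, basic a l1 e1 c -> basic b l2 e2 d -> O c d.

Definition H2_closure (A : H2Set) : H2Set :=
  fun a b => in_H a /\ in_H b /\
    forall O, H2_open O -> O a b -> exists c d, O c d /\ A c d.

Definition H2_nowhere_dense (A : H2Set) : Prop :=
  ~ exists O, H2_open O /\ (exists a b, O a b) /\
      (forall a b, O a b -> H2_closure A a b).

Definition H2_meager (A : H2Set) : Prop :=
  exists An : nat -> H2Set, (forall n, H2_nowhere_dense (An n)) /\
    forall a b, A a b -> exists n, An n a b.

Definition sim_class (f1 f2 : R -> R) : H2Set :=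
  fun g1 g2 => in_H g1 /\ in_H g2 /\ top_similar g1 g2 f1 f2.

(* Main.v *)
Require Import Defs.
From Stdlib Require Import Reals Lra Lia List Sorted ClassicalEpsilon.
From Stdlib Require Import FunctionalExtensionality FinFun.
From Coquelicot Require Import Hierarchy Rcomplements.
Import ListNotations.

(** Let f = (f1, f2).  Two cases.

    Suppose every neighbourhood of the identity contains w(f) for some nonempty
    reduced word w.  If g is similar to f, there is a neighbourhood U of the
    identity, taken from a countable base, such that w(g)(1/2) <= 3/4 whenever
    w(f) is in U.  For fixed U the set of such g is nowhere dense: a basic open
    set contains a pair g without common fixed points in (0,1), so some word u
    pushes 1/2 beyond 3/4 and beyond all the points constrained by the open set.
    If w(f) is close enough to the identity, then the conjugate of w by u
    evaluates at f to an element of U, and g can be redefined near 1 so that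
    every letter of this conjugate after u moves the current point further up:
    the values needed are prescribed one letter at a time, and reducedness is
    exactly what prevents conflicts.

    Otherwise the words w(f), and hence the words w(g) for g similar to f, avoid
    some neighbourhood of the identity.  For a fixed neighbourhood the set of
    such g is nowhere dense, because pairs satisfying a nontrivial relation are
    dense: if g1 = g2 near 0 and near 1 and g has no common fixed point in (0,1),
    then g1^-1 g2 commutes with one of its conjugates. *)

(** * Order automorphisms of the line *)

Definition order_auto (f : R -> R) : Prop := strict_increasing f /\ Surjective f.

Lemma order_auto_lt f x y : order_auto f -> x < y -> f x < f y.
Proof. intros [Hlt _]; apply Hlt. Qed.

Lemma order_auto_le f x y : order_auto f -> x <= y -> f x <= f y.
Proof. intros [Hlt _] [Hxy | ->]; [apply Hlt in Hxy|]; lra. Qed.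

Lemma order_auto_lt_inv f x y : order_auto f -> f x < f y -> x < y.
Proof.
  intros Hf Hxy; destruct (Rlt_or_le x y) as [|Hyx]; auto.
  apply (order_auto_le f) in Hyx; auto; lra.
Qed.

Lemma order_auto_le_inv f x y : order_auto f -> f x <= f y -> x <= y.
Proof.
  intros Hf Hxy; destruct (Rle_or_lt x y) as [|Hyx]; auto.
  apply (order_auto_lt f) in Hyx; auto; lra.
Qed.

Lemma order_auto_inj f : order_auto f -> Injective f.
Proof. intros Hf x y Hxy; apply Rle_antisym; apply (order_auto_le_inv f); auto; lra. Qed.

Lemma order_auto_id : order_auto (fun x => x).
Proof. split; [intros x y; auto|intros y; eauto]. Qed.

Lemma order_auto_comp f g : order_auto f -> order_auto g -> order_auto (fun x => f (g x)).
Proof.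
  intros [f_lt f_surj] [g_lt g_surj]; split; [intros x y Hxy; auto|].
  intros y; destruct (f_surj y) as [z <-]; destruct (g_surj z) as [x <-]; eauto.
Qed.

Definition hinv (f : R -> R) (y : R) : R := epsilon (inhabits 0) (fun x => f x = y).

Lemma hinvK f y : order_auto f -> f (hinv f y) = y.
Proof. intros [_ f_surj]; unfold hinv; apply epsilon_spec; auto. Qed.

Lemma Khinv f x : order_auto f -> hinv f (f x) = x.
Proof. intros Hf; apply (order_auto_inj f); auto using hinvK. Qed.

Lemma order_auto_hinv f : order_auto f -> order_auto (hinv f).
Proof.
  intros Hf; split.
  - intros x y Hxy; apply (order_auto_lt_inv f); auto; rewrite !hinvK; auto.
  - intros x; exists (f x); apply Khinv; auto.
Qed.

Lemma hinv_hinv f x : order_auto f -> hinv (hinv f) x = f x.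
Proof.
  intros Hf; pose proof (order_auto_hinv f Hf) as Hinv.
  apply (order_auto_inj (hinv f)); auto. rewrite hinvK, Khinv; auto.
Qed.

Lemma order_auto_continuous f x eps : order_auto f -> 0 < eps ->
  exists delta, 0 < delta /\
    forall y, Rabs (y - x) < delta -> Rabs (f y - f x) < eps.
Proof.
  intros Hf eps_pos.
  destruct (proj2 Hf (f x - eps)) as [p fp]; destruct (proj2 Hf (f x + eps)) as [q fq].
  assert (p < x) by (apply (order_auto_lt_inv f); auto; lra).
  assert (x < q) by (apply (order_auto_lt_inv f); auto; lra).
  exists (Rmin (x - p) (q - x)); split; [apply Rmin_pos; lra|].
  intros y Hy; apply Rabs_def2 in Hy.
  pose proof (Rmin_l (x - p) (q - x)); pose proof (Rmin_r (x - p) (q - x)).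
  assert (f p < f y) by (apply order_auto_lt; auto; lra).
  assert (f y < f q) by (apply order_auto_lt; auto; lra).
  apply Rabs_def1; lra.
Qed.

Lemma disjoint_supports_commute (h k : R -> R) : Injective h -> Injective k ->
  (forall x, h x = x \/ k x = x) -> forall x, h (k x) = k (h x).
Proof.
  intros h_inj k_inj disjoint x.
  destruct (Req_dec (h x) x) as [hx|hx].
  - destruct (Req_dec (k x) x) as [kx|kx]; [congruence|].
    destruct (disjoint (k x)) as [hkx|kkx]; [congruence|].
    apply k_inj in kkx; contradiction.
  - destruct (disjoint x) as [|kx]; [contradiction|].
    destruct (disjoint (h x)) as [hhx|khx]; [apply h_inj in hhx; contradiction|congruence].
Qed.

(** * The group [H] *)

Lemma in_H_outside f x : in_H f -> ~ 0 < x < 1 -> f x = x.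
Proof.
  intros (f_off & f_I01 & _ & f_surj & _ & _ & f_le) Hx.
  destruct (classic (I01 x)) as [x_I01|]; auto.
  assert (endpoint : x = 0 \/ x = 1) by (unfold I01 in x_I01; lra).
  destruct (f_surj x x_I01) as (z & z_I01 & fz).
  pose proof (f_I01 x x_I01) as fx_I01.
  destruct endpoint; subst x;
    [pose proof (f_le 0 z x_I01 z_I01)|pose proof (f_le z 1 z_I01 x_I01)];
    unfold I01 in *; lra.
Qed.

Lemma in_H_order_auto f : in_H f -> order_auto f.
Proof.
  intros (f_off & f_I01 & f_inj & f_surj & _ & _ & f_le); split.
  - intros x y Hxy.
    destruct (classic (I01 x)) as [Hx|Hx]; destruct (classic (I01 y)) as [Hy|Hy];
      try rewrite (f_off x Hx); try rewrite (f_off y Hy); auto.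
    + destruct (f_le x y) as [|fxy]; auto; try lra. apply f_inj in fxy; auto; lra.
    + specialize (f_I01 x Hx); unfold I01 in *; lra.
    + specialize (f_I01 y Hy); unfold I01 in *; lra.
  - intros y; destruct (classic (I01 y)) as [Hy|Hy]; [|eauto].
    destruct (f_surj y Hy) as (x & _ & fx); eauto.
Qed.

Lemma in_H_intro f : order_auto f -> (forall x, ~ 0 < x < 1 -> f x = x) -> in_H f.
Proof.
  intros Hf f_off.
  assert (f0 : f 0 = 0) by (apply f_off; lra).
  assert (f1 : f 1 = 1) by (apply f_off; lra).
  unfold in_H; repeat apply conj.
  - intros x Hx; apply f_off; unfold I01 in Hx; lra.
  - intros x [x_ge0 x_le1].
    apply (order_auto_le f) in x_ge0, x_le1; auto; unfold I01; lra.
  - intros x y _ _; apply order_auto_inj; auto.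
  - intros y [y_ge0 y_le1]; destruct (proj2 Hf y) as [x fx]; exists x.
    repeat split; auto; apply (order_auto_le_inv f); auto; lra.
  - intros x _ eps eps_pos.
    destruct (order_auto_continuous f x eps Hf eps_pos) as (delta & ? & ?); eauto.
  - intros x _ eps eps_pos.
    destruct (order_auto_continuous (hinv f) (f x) eps) as (delta & ? & Hd);
      auto using order_auto_hinv.
    exists delta; split; auto. intros y _ Hy.
    specialize (Hd _ Hy); rewrite !Khinv in Hd; auto.
  - intros x y _ _; apply order_auto_le; auto.
Qed.

Lemma in_H_interior f x : in_H f -> 0 < x < 1 -> 0 < f x < 1.
Proof.
  intros Hf Hx; pose proof (in_H_order_auto f Hf).
  assert (f 0 < f x) by (apply order_auto_lt; auto; lra).
  assert (f x < f 1) by (apply order_auto_lt; auto; lra).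
  rewrite (in_H_outside f 0), (in_H_outside f 1) in *; auto; lra.
Qed.

Lemma in_H_id : in_H (fun x => x).
Proof. apply in_H_intro; auto using order_auto_id. Qed.

Lemma in_H_comp f g : in_H f -> in_H g -> in_H (fun x => f (g x)).
Proof.
  intros Hf Hg; apply in_H_intro; [auto using order_auto_comp, in_H_order_auto|].
  intros x Hx; rewrite (in_H_outside g) by auto; apply in_H_outside; auto.
Qed.

Lemma in_H_hinv f : in_H f -> in_H (hinv f).
Proof.
  intros Hf; pose proof (in_H_order_auto f Hf).
  apply in_H_intro; [apply order_auto_hinv; auto|].
  intros x Hx; rewrite <- (in_H_outside f x) at 1 by auto; apply Khinv; auto.
Qed.

Lemma in_H_gen f1 f2 h : in_H f1 -> in_H f2 -> gen f1 f2 h -> in_H h.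
Proof.
  intros Hf1 Hf2; induction 1 as [| | | |h k _ Hh kh hk]; auto using in_H_id, in_H_comp.
  replace k with (hinv h); [apply in_H_hinv; auto|].
  extensionality x; rewrite <- (hk x) at 1; apply Khinv, in_H_order_auto; auto.
Qed.

(** * Neighbourhoods *)

Lemma filter_forall_In {T A : Type} (F : (T -> Prop) -> Prop) {FF : Filter F}
    (P : A -> T -> Prop) (l : list A) :
  (forall a, In a l -> F (P a)) -> F (fun x => forall a, In a l -> P a x).
Proof.
  induction l as [|a l IH]; intros HP; [apply filter_forall; contradiction|].
  generalize (filter_and _ _ (HP a (in_eq a l)) (IH (fun b Hb => HP b (in_cons a b l Hb)))).
  apply filter_imp; intros x [Hax Hlx] b [<-|Hb]; auto.
Qed.

Lemma at_right_0_lt e : 0 < e -> at_right 0 (fun d => 0 < d < e).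
Proof.
  intros e_pos; exists (mkposreal e e_pos); intros d Hd d_pos.
  apply Rabs_def2 in Hd; unfold minus, plus, opp in Hd; simpl in Hd; lra.
Qed.

Lemma at_right_0_ex e P : at_right 0 P -> 0 < e -> exists d, 0 < d < e /\ P d.
Proof.
  intros HP e_pos; exact (filter_ex _ (filter_and _ _ (at_right_0_lt e e_pos) HP)).
Qed.

Lemma at_right_0_gap {A : Type} (v : A -> R) (l : list A) :
  at_right 0 (fun d => forall a, In a l -> v a <= 0 \/ d < v a).
Proof.
  apply (filter_forall_In (at_right 0)); intros a _.
  destruct (Rle_or_lt (v a) 0) as [|v_pos]; [apply filter_forall; auto|].
  generalize (at_right_0_lt (v a) v_pos); apply filter_imp; tauto.
Qed.

Definition nbhs (f : R -> R) (P : HSet) : Prop :=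
  exists l eps, basic_ok l eps /\ forall g, basic f l eps g -> P g.

#[global] Instance nbhs_filter f : Filter (nbhs f).
Proof.
  constructor.
  - exists [], 1; split; [split; [intros a []|lra]|auto].
  - intros P Q (l & eps & [Hl eps_pos] & HP) (l' & eps' & [Hl' eps'_pos] & HQ).
    exists (l ++ l'), (Rmin eps eps'); split.
    + split; [intros a Ha; apply in_app_or in Ha; destruct Ha; auto|apply Rmin_pos; auto].
    + pose proof (Rmin_l eps eps'); pose proof (Rmin_r eps eps').
      intros g [Hg Hnear]; split; [apply HP|apply HQ]; split; auto; intros a Ha;
        (eapply Rlt_le_trans; [apply Hnear, in_or_app|]); auto.
  - intros P Q HPQ (l & eps & Hok & HP); exists l, eps; split; auto.
Qed.

Lemma nbhs_in_H f : nbhs f in_H.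
Proof. exists [], 1; split; [split; [intros a []|lra]|intros g [Hg _]; auto]. Qed.

Lemma nbhs_eval f x eps : in_H f -> 0 < eps -> nbhs f (fun g => Rabs (g x - f x) < eps).
Proof.
  intros Hf eps_pos; destruct (classic (I01 x)) as [Hx|Hx].
  - exists [x], eps; split; [split; auto; intros a [<-|[]]; auto|].
    intros g [_ Hnear]; apply Hnear, in_eq.
  - generalize (nbhs_in_H f); apply filter_imp; intros g Hg.
    rewrite (in_H_outside f), (in_H_outside g), Rminus_diag, Rabs_R0;
      auto; unfold I01 in Hx; lra.
Qed.

Lemma nbhs_gt f x y : in_H f -> y < f x -> nbhs f (fun g => y < g x).
Proof.
  intros Hf Hy; generalize (nbhs_eval f x (f x - y) Hf (proj2 (Rlt_0_minus _ _) Hy)).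
  apply filter_imp; intros g Hg; apply Rabs_def2 in Hg; lra.
Qed.

Lemma nbhs_lt f x y : in_H f -> f x < y -> nbhs f (fun g => g x < y).
Proof.
  intros Hf Hy; generalize (nbhs_eval f x (y - f x) Hf (proj2 (Rlt_0_minus _ _) Hy)).
  apply filter_imp; intros g Hg; apply Rabs_def2 in Hg; lra.
Qed.

Lemma basic_self f l eps : in_H f -> 0 < eps -> basic f l eps f.
Proof. intros Hf eps_pos; split; auto; intros; rewrite Rminus_diag, Rabs_R0; auto. Qed.

Lemma H_open_basic f l eps : (forall a, In a l -> I01 a) -> H_open (basic f l eps).
Proof.
  intros Hl; split; [intros g [Hg _]; auto|]. intros g [Hg Hnear].
  destruct (at_right_0_ex 1 _ (at_right_0_gap (fun a => eps - Rabs (g a - f a)) l) Rlt_0_1)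
    as (d & [d_pos _] & margin).
  exists l, d; split; [split; auto|]. intros h [Hh Hnear']; split; auto.
  intros a Ha; specialize (Hnear a Ha); specialize (margin a Ha); specialize (Hnear' a Ha).
  replace (h a - f a) with ((h a - g a) + (g a - f a)) by ring.
  pose proof (Rabs_triang (h a - g a) (g a - f a)); lra.
Qed.

(** * Words in two generators *)

Definition homeo_pair : Type := (R -> R) * (R -> R).

Definition generator (g : homeo_pair) (i : bool) : R -> R := if i then fst g else snd g.

Definition Hpair (g : homeo_pair) : Prop := forall i, in_H (generator g i).

(* The letter [(i, true)] stands for the generator [i], and [(i, false)] for its
   inverse.  Words are written in order of application: the head acts first. *)
Definition letter : Type := bool * bool.

Definition linv (a : letter) : letter := (fst a, negb (snd a)).

Definition winv (w : list letter) : list letter := rev (map linv w).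

Definition act (g : homeo_pair) (a : letter) : R -> R :=
  if snd a then generator g (fst a) else hinv (generator g (fst a)).

Fixpoint run (g : homeo_pair) (w : list letter) (x : R) : R :=
  match w with
  | [] => x
  | a :: w' => run g w' (act g a x)
  end.

Lemma Hpair_intro a b : in_H a -> in_H b -> Hpair (a, b).
Proof. intros Ha Hb []; auto. Qed.

Lemma linvK a : linv (linv a) = a.
Proof. destruct a as [i []]; reflexivity. Qed.

Lemma letter_cases (a b : letter) : a = b \/ a = linv b \/ fst a <> fst b.
Proof. destruct a as [[] []], b as [[] []]; unfold linv; simpl; auto. Qed.

Lemma letter_avoiding (a b c : letter) : exists d, d <> a /\ d <> b /\ d <> c.
Proof.
  destruct a as [[] []], b as [[] []], c as [[] []];
    first [exists (true, true); repeat split; discriminate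
          |exists (true, false); repeat split; discriminate
          |exists (false, true); repeat split; discriminate
          |exists (false, false); repeat split; discriminate].
Qed.

Lemma winv_app v w : winv (v ++ w) = winv w ++ winv v.
Proof. unfold winv; rewrite map_app, rev_app_distr; reflexivity. Qed.

Lemma winvK w : winv (winv w) = w.
Proof.
  unfold winv; rewrite map_rev, rev_involutive, map_map.
  rewrite (map_ext _ (fun a => a) linvK); apply map_id.
Qed.

Lemma in_H_act g a : Hpair g -> in_H (act g a).
Proof. intros Hg; unfold act; destruct (snd a); auto using in_H_hinv. Qed.

Lemma order_auto_act g a : Hpair g -> order_auto (act g a).
Proof. intros Hg; apply in_H_order_auto, in_H_act; auto. Qed.

Lemma act_linvK g a x : Hpair g -> act g (linv a) (act g a x) = x.
Proof.
  intros Hg; pose proof (in_H_order_auto _ (Hg (fst a))).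
  destruct a as [i []]; unfold act, linv; simpl in *; auto using hinvK, Khinv.
Qed.

Lemma act_Klinv g a x : Hpair g -> act g a (act g (linv a) x) = x.
Proof. intros Hg; rewrite <- (linvK a) at 1; apply act_linvK; auto. Qed.

Lemma act_linv_eq g a x y : Hpair g -> act g a x = y -> act g (linv a) y = x.
Proof. intros Hg <-; apply act_linvK; auto. Qed.

Lemma in_H_run g w : Hpair g -> in_H (run g w).
Proof.
  intros Hg; induction w as [|a w IH]; [exact in_H_id|].
  exact (in_H_comp _ _ IH (in_H_act g a Hg)).
Qed.

Lemma order_auto_run g w : Hpair g -> order_auto (run g w).
Proof. intros Hg; apply in_H_order_auto, in_H_run; auto. Qed.

Lemma run_app g v w x : run g (v ++ w) x = run g w (run g v x).
Proof. revert x; induction v as [|a v IH]; simpl; auto. Qed.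

Lemma run_winvK g w x : Hpair g -> run g (winv w) (run g w x) = x.
Proof.
  intros Hg; revert x; induction w as [|a w IH]; intros x; auto.
  change (winv (a :: w)) with (winv w ++ [linv a]).
  rewrite run_app; simpl; rewrite IH; apply act_linvK; auto.
Qed.

Lemma run_Kwinv g w x : Hpair g -> run g w (run g (winv w) x) = x.
Proof. intros Hg; rewrite <- (winvK w) at 1; apply run_winvK; auto. Qed.

Lemma run_commutator g v w : Hpair g ->
  (forall x, run g v (run g w x) = run g w (run g v x)) ->
  forall x, run g (v ++ w ++ winv v ++ winv w) x = x.
Proof.
  intros Hg commute x; rewrite !run_app, <- commute, run_winvK by auto.
  apply run_winvK; auto.
Qed.

Definition reduced : list letter -> Prop := Sorted (fun a b => b <> linv a).

Lemma reduced_overlap v a w : reduced (v ++ a :: w) <-> reduced (v ++ [a]) /\ reduced (a :: w).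
Proof.
  unfold reduced; induction v as [|b v IH]; simpl; [intuition auto|].
  split.
  - intros Hr; apply Sorted_inv in Hr as [Hr Hb]; apply IH in Hr; destruct Hr as [Hva Haw].
    split; auto; constructor; auto; destruct v; inversion Hb; constructor; auto.
  - intros [Hr Haw]; apply Sorted_inv in Hr as [Hva Hb].
    constructor; [apply IH; auto|destruct v; inversion Hb; constructor; auto].
Qed.

Lemma reduced_app v a b w : reduced (v ++ [a]) -> reduced (b :: w) -> b <> linv a ->
  reduced ((v ++ [a]) ++ b :: w).
Proof.
  intros Hva Hbw Hab; rewrite <- app_assoc; apply reduced_overlap; split; auto.
  constructor; auto.
Qed.

Lemma reduced_winv w : reduced w -> reduced (winv w).
Proof.
  induction w as [|a w IH]; intros Hr; [exact Hr|].
  apply Sorted_inv in Hr as [Hw Ha].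
  change (winv (a :: w)) with (winv w ++ [linv a]).
  destruct w as [|b w]; [repeat constructor|].
  apply reduced_app; [exact (IH Hw)|repeat constructor|].
  rewrite linvK; intros <-; inversion Ha as [|? ? Hab]; contradiction.
Qed.

(** * Neighbourhoods of pairs *)

Definition nbhs2 (g : homeo_pair) : (homeo_pair -> Prop) -> Prop :=
  filter_prod (nbhs (fst g)) (nbhs (snd g)).

#[global] Instance nbhs2_filter g : Filter (nbhs2 g).
Proof. apply filter_prod_filter; apply nbhs_filter. Qed.

Lemma nbhs2_generator g i P :
  nbhs (generator g i) P -> nbhs2 g (fun h => P (generator h i)).
Proof. destruct i; [apply filterlim_fst|apply filterlim_snd]. Qed.

Lemma nbhs2_Hpair g : nbhs2 g Hpair.
Proof.
  generalize (filter_and _ _ (nbhs2_generator g true _ (nbhs_in_H _))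
    (nbhs2_generator g false _ (nbhs_in_H _))).
  apply filter_imp; intros h [Ht Hf] []; auto.
Qed.

Lemma nbhs2_act_gt g a x y : Hpair g -> y < act g a x -> nbhs2 g (fun h => y < act h a x).
Proof.
  intros Hg Hy; pose proof (order_auto_act g a Hg) as Ha.
  destruct a as [i []]; unfold act in *; simpl in *.
  - apply (nbhs2_generator g i (fun f => y < f x)), nbhs_gt; auto.
  - assert (Hx : generator g i y < x).
    { apply (order_auto_lt_inv (hinv (generator g i))); auto.
      rewrite Khinv; auto using in_H_order_auto. }
    generalize (filter_and _ _ (nbhs2_Hpair g)
      (nbhs2_generator g i (fun f => f y < x) (nbhs_lt _ _ _ (Hg i) Hx))).
    apply filter_imp; intros h [Hh Hhy]; pose proof (in_H_order_auto _ (Hh i)).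
    apply (order_auto_lt_inv (generator h i)); auto. rewrite hinvK; auto.
Qed.

Lemma nbhs2_run_gt g w x y : Hpair g -> y < run g w x -> nbhs2 g (fun h => y < run h w x).
Proof.
  intros Hg; revert x; induction w as [|a w IH]; simpl; intros x Hy.
  { apply filter_forall; auto. }
  set (z := run g (winv w) y).
  assert (Hz : z < act g a x).
  { apply (order_auto_lt_inv (run g w)); [apply order_auto_run; auto|].
    unfold z; rewrite run_Kwinv; auto. }
  set (m := (z + act g a x) / 2).
  assert (Hm : y < run g w m).
  { rewrite <- (run_Kwinv g w y) by auto.
    apply order_auto_lt; [apply order_auto_run; auto|unfold m, z in *; lra]. }
  assert (Hmx : m < act g a x) by (unfold m; lra).
  generalize (filter_and _ _ (nbhs2_Hpair g)
    (filter_and _ _ (IH m Hm) (nbhs2_act_gt g a x m Hg Hmx))).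
  apply filter_imp; intros h (Hh & Hhm & Hhx).
  eapply Rlt_trans; [exact Hhm|apply order_auto_lt; auto using order_auto_run].
Qed.

Lemma nbhs2_run_lt g w x y : Hpair g -> run g w x < y -> nbhs2 g (fun h => run h w x < y).
Proof.
  intros Hg Hy.
  assert (Hx : x < run g (winv w) y).
  { rewrite <- (run_winvK g w x) by auto. apply order_auto_lt; auto using order_auto_run. }
  generalize (filter_and _ _ (nbhs2_Hpair g) (nbhs2_run_gt g (winv w) y x Hg Hx)).
  apply filter_imp; intros h [Hh Hhx].
  rewrite <- (run_Kwinv h w y) by auto. apply order_auto_lt; auto using order_auto_run.
Qed.

Lemma nbhs2_run_basic g w f l eps : Hpair g -> basic f l eps (run g w) ->
  nbhs2 g (fun h => basic f l eps (run h w)).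
Proof.
  intros Hg [_ Hnear].
  assert (Hl : nbhs2 g (fun h => forall a, In a l -> Rabs (run h w a - f a) < eps)).
  { apply (filter_forall_In (nbhs2 g)); intros a Ha.
    specialize (Hnear a Ha); apply Rabs_def2 in Hnear.
    assert (Hlt : run g w a < f a + eps) by lra.
    assert (Hgt : f a - eps < run g w a) by lra.
    generalize (filter_and _ _ (nbhs2_run_lt g w a _ Hg Hlt) (nbhs2_run_gt g w a _ Hg Hgt)).
    apply filter_imp; intros h Hh; apply Rabs_def1; lra. }
  generalize (filter_and _ _ (nbhs2_Hpair g) Hl).
  apply filter_imp; intros h [Hh Hhl]; split; auto using in_H_run.
Qed.

Definition near (l : list R) (eps : R) (g g' : homeo_pair) : Prop :=
  forall i a, In a l -> Rabs (generator g' i a - generator g i a) < eps.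

Definition dense (P : homeo_pair -> Prop) : Prop :=
  forall g l eps, Hpair g -> 0 < eps -> exists g', Hpair g' /\ near l eps g g' /\ P g'.

Lemma H2_open_rect A B : H_open A -> H_open B -> H2_open (fun a b => A a /\ B b).
Proof.
  intros [A_in_H A_open] [B_in_H B_open]; split; [intros a b []; auto|].
  intros a b [Ha Hb].
  destruct (A_open a Ha) as (l & eps & ? & ?); destruct (B_open b Hb) as (l' & eps' & ? & ?).
  exists l, eps, l', eps'; auto.
Qed.

Lemma nowhere_dense_of_dense_avoidance (A : H2Set) :
  dense (fun g => nbhs2 g (fun h => ~ A (fst h) (snd h))) -> H2_nowhere_dense A.
Proof.
  intros A_avoided (O & [O_in_H O_open] & (a & b & Oab) & O_closure).
  destruct (O_in_H a b Oab) as [Ha Hb].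
  destruct (O_open a b Oab) as (l1 & e1 & l2 & e2 & [Hl1 e1_pos] & [Hl2 e2_pos] & HO).
  destruct (A_avoided (a, b) (l1 ++ l2) (Rmin e1 e2)) as ([c d] & Hcd & Hnear & Havoid);
    [apply Hpair_intro; auto|apply Rmin_pos; auto|].
  pose proof (Hcd true : in_H c) as Hc; pose proof (Hcd false : in_H d) as Hd.
  assert (Ocd : O c d).
  { apply HO; split; auto; intros x Hx;
      [pose proof (Hnear true x (in_or_app _ _ _ (or_introl Hx)))
      |pose proof (Hnear false x (in_or_app _ _ _ (or_intror Hx)))];
      pose proof (Rmin_l e1 e2); pose proof (Rmin_r e1 e2); simpl in *; lra. }
  destruct Havoid as [P Q (lc & ec & [Hlc ec_pos] & HP) (ld & ed & [Hld ed_pos] & HQ) HPQ].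
  destruct (O_closure c d Ocd) as (_ & _ & meets).
  destruct (meets (fun a b => basic c lc ec a /\ basic d ld ed b))
    as (a' & b' & [Ha' Hb'] & HA).
  - apply H2_open_rect; apply H_open_basic; auto.
  - split; apply basic_self; auto.
  - exact (HPQ a' b' (HP a' Ha') (HQ b' Hb') HA).
Qed.

(** * Piecewise linear modifications *)

Definition glue (c : R) (f g : R -> R) (x : R) : R := if Rle_dec x c then f x else g x.

Lemma order_auto_glue c f g : order_auto f -> order_auto g -> f c = g c ->
  order_auto (glue c f g).
Proof.
  intros Hf Hg fgc; unfold glue; split.
  - intros x y Hxy; destruct (Rle_dec x c), (Rle_dec y c); try lra;
      try (apply order_auto_lt; auto).
    apply Rle_lt_trans with (f c); [apply order_auto_le; auto|].
    rewrite fgc; apply order_auto_lt; auto; lra.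
  - intros y; destruct (Rle_or_lt y (f c)) as [Hy|Hy].
    + destruct (proj2 Hf y) as [x fx]; exists x; destruct (Rle_dec x c) as [|Hx]; auto.
      contradict Hx; apply (order_auto_le_inv f); auto; lra.
    + destruct (proj2 Hg y) as [x gx]; exists x; destruct (Rle_dec x c) as [Hx|]; auto.
      apply (order_auto_le g) in Hx; auto; lra.
Qed.

Definition line (p q p' q' x : R) : R := q + (x - p) * ((q' - q) / (p' - p)).

Lemma line_left p q p' q' : line p q p' q' p = q.
Proof. unfold line; lra. Qed.

Lemma line_right p q p' q' : p < p' -> line p q p' q' p' = q'.
Proof. intros; unfold line; field; lra. Qed.

Lemma order_auto_line p q p' q' : p < p' -> q < q' -> order_auto (line p q p' q').
Proof.
  intros Hp Hq; assert (slope_pos : 0 < (q' - q) / (p' - p)) by (apply Rdiv_lt_0_compat; lra).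
  unfold line; set (s := (q' - q) / (p' - p)) in *; split.
  - intros x y Hxy; assert (x * s < y * s) by (apply Rmult_lt_compat_r; auto); lra.
  - intros y; exists (p + (y - q) / s); field; lra.
Qed.

Lemma line_fixpoint_unique p q p' q' x y : p < p' -> q <> p \/ q' <> p' ->
  line p q p' q' x = x -> line p q p' q' y = y -> x = y.
Proof.
  intros Hp off_diagonal Hx Hy; unfold line in *.
  set (s := (q' - q) / (p' - p)) in *.
  assert (rise : q' - q = s * (p' - p)) by (unfold s; field; lra).
  assert (Hxy : (x - y) * (s - 1) = 0) by lra.
  apply Rmult_integral in Hxy as [|slope_1]; [lra|].
  replace s with 1 in * by lra; lra.
Qed.

(* Replaces [f] on [(a, b)] by two segments meeting at the point [(s, t)]. *)
Definition through (a b s t : R) (f : R -> R) : R -> R :=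
  glue a f (glue s (line a (f a) s t) (glue b (line s t b (f b)) f)).

Definition agree_outside (p q : R) (f f' : R -> R) : Prop :=
  forall z, ~ p < z < q -> f' z = f z.

Lemma through_off a b s t f : a < s < b -> agree_outside a b f (through a b s t f).
Proof.
  intros Hs z Hz; unfold through, glue.
  destruct (Rle_dec z a), (Rle_dec z s), (Rle_dec z b); try lra.
  replace z with b by lra; apply line_right; lra.
Qed.

Lemma through_left a b s t f z : a < s < b -> a <= z <= s ->
  through a b s t f z = line a (f a) s t z.
Proof.
  intros Hs Hz; unfold through, glue.
  destruct (Rle_dec z a), (Rle_dec z s); try lra.
  replace z with a by lra; rewrite line_left; auto.
Qed.

Lemma through_right a b s t f z : a < s < b -> s <= z <= b ->
  through a b s t f z = line s t b (f b) z.
Proof.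
  intros Hs Hz; unfold through, glue.
  destruct (Rle_dec z a), (Rle_dec z s), (Rle_dec z b); try lra.
  replace z with s by lra; rewrite line_left, line_right; lra.
Qed.

Lemma through_at a b s t f : a < s < b -> through a b s t f s = t.
Proof. intros Hs; rewrite through_right, line_left; lra. Qed.

Lemma order_auto_through a b s t f : order_auto f -> a < s < b -> f a < t < f b ->
  order_auto (through a b s t f).
Proof.
  intros Hf Hs Ht; unfold through.
  repeat apply order_auto_glue; auto; try (apply order_auto_line; lra);
    unfold glue; repeat destruct Rle_dec; try lra;
    rewrite ?line_left, ?line_right; lra.
Qed.

Lemma in_H_agree_outside f f' p q : in_H f -> order_auto f' -> 0 <= p -> q <= 1 ->
  agree_outside p q f f' -> in_H f'.
Proof.
  intros Hf Hf' Hp Hq f'_off; apply in_H_intro; auto.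
  intros x Hx; rewrite f'_off by lra; apply in_H_outside; auto.
Qed.

Lemma in_H_through a b s t f : in_H f -> 0 <= a -> b <= 1 -> a < s < b -> f a < t < f b ->
  in_H (through a b s t f).
Proof.
  intros Hf Ha Hb Hs Ht; apply (in_H_agree_outside f _ a b); auto.
  - apply order_auto_through; auto using in_H_order_auto.
  - apply through_off; auto.
Qed.

Definition standard_ends (e : R) (f : R -> R) : Prop :=
  (forall z, 0 <= z <= e -> f z = z / 2) /\
  (forall z, 1 - e <= z <= 1 -> f z = (1 + z) / 2).

Lemma eventually_standard_ends f l : in_H f ->
  at_right 0 (fun e => exists f', in_H f' /\ standard_ends e f' /\
    forall a, In a l -> f' a = f a).
Proof.
  intros Hf.
  destruct (at_right_0_ex (1 / 2) _ (filter_and _ _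
    (at_right_0_gap (fun a => a) l) (at_right_0_gap (fun a => 1 - a) l)))
    as (p & Hp & gap_0 & gap_1); [lra|].
  assert (fp : 0 < f p < 1) by (apply in_H_interior; auto; lra).
  assert (fp' : 0 < f (1 - p) < 1) by (apply in_H_interior; auto; lra).
  assert (f0 : f 0 = 0) by (apply in_H_outside; auto; lra).
  assert (f1 : f 1 = 1) by (apply in_H_outside; auto; lra).
  assert (bound_pos : 0 < Rmin p (Rmin (f p) (1 - f (1 - p))))
    by (repeat apply Rmin_pos; lra).
  generalize (at_right_0_lt _ bound_pos); apply filter_imp; intros e [e_pos He].
  apply Rmin_Rgt_l in He as [e_p He]; apply Rmin_Rgt_l in He as [e_fp e_fp'].
  set (h := through (1 - p) 1 (1 - e) (1 - e / 2) f).
  assert (Hh : in_H h) by (apply in_H_through; auto; lra).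
  assert (h_off : agree_outside (1 - p) 1 f h) by (apply through_off; lra).
  assert (h0 : h 0 = 0) by (rewrite h_off; lra).
  assert (hp : h p = f p) by (apply h_off; lra).
  exists (through 0 p e (e / 2) h); split; [|split; [split|]].
  - apply in_H_through; auto; lra.
  - intros z Hz; rewrite through_left, h0 by lra; unfold line; field; lra.
  - intros z Hz; rewrite through_off by lra.
    unfold h; rewrite through_right, f1 by lra; unfold line; field; lra.
  - intros a Ha; specialize (gap_0 a Ha); specialize (gap_1 a Ha); simpl in *.
    rewrite through_off, h_off; lra.
Qed.

Lemma raise_value f p q a L e : order_auto f -> p < a < q -> 0 < e ->
  exists f', order_auto f' /\ agree_outside p q f f' /\
    (forall z, In z L -> z <> a -> f' z = f z) /\ f a < f' a < f a + e.
Proof.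
  intros Hf Ha e_pos.
  destruct (at_right_0_ex (Rmin (a - p) (q - a)) _
    (at_right_0_gap (fun z => Rabs (z - a)) L)) as (d & [d_pos d_small] & isolated);
    [apply Rmin_pos; lra|].
  apply Rmin_Rgt_l in d_small as [d_p d_q].
  assert (f (a - d) < f a) by (apply order_auto_lt; auto; lra).
  assert (f a < f (a + d)) by (apply order_auto_lt; auto; lra).
  assert (f a < Rmin (f (a + d)) (f a + e)) by (apply Rmin_glb_lt; lra).
  pose proof (Rmin_l (f (a + d)) (f a + e)); pose proof (Rmin_r (f (a + d)) (f a + e)).
  set (t := (f a + Rmin (f (a + d)) (f a + e)) / 2).
  exists (through (a - d) (a + d) a t f); split; [|split; [|split]].
  - apply order_auto_through; auto; unfold t; lra.
  - intros z Hz; apply through_off; lra.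
  - intros z Hz z_ne; apply through_off; [lra|].
    specialize (isolated z Hz); simpl in isolated; split_Rabs; lra.
  - rewrite through_at; unfold t; lra.
Qed.

Lemma avoid_fixpoints f p q L eps : order_auto f -> 0 < eps -> forall F, incl F L ->
  exists f', order_auto f' /\ agree_outside p q f f' /\
    (forall z, In z L -> Rabs (f' z - f z) < eps) /\
    (forall z, In z F -> p < z < q -> f' z <> z).
Proof.
  intros Hf eps_pos F; induction F as [|a F IH]; intros F_L.
  { exists f; split; [|split; [|split]]; auto; [intros z _; auto|].
    intros; rewrite Rminus_diag, Rabs_R0; auto. }
  apply incl_cons_inv in F_L as [a_L F_L].
  destruct (IH F_L) as (k & Hk & k_off & k_near & k_F).
  destruct (classic (p < a < q /\ k a = a)) as [[Ha ka]|Ha].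
  - assert (slack : 0 < eps - Rabs (k a - f a)) by (specialize (k_near a a_L); lra).
    destruct (raise_value k p q a L _ Hk Ha slack) as (h & Hh & h_off & h_L & ha).
    exists h; split; [|split; [|split]]; auto.
    + intros z Hz; rewrite h_off; auto.
    + intros z Hz; destruct (Req_dec z a) as [->|z_ne]; [|rewrite h_L; auto].
      split_Rabs; lra.
    + intros z [<-|Hz] Hpq; [lra|].
      destruct (Req_dec z a) as [->|z_ne]; [lra|rewrite h_L; auto].
  - exists k; split; [|split; [|split]]; auto.
    intros z [<-|Hz]; auto.
Qed.

Lemma subsingleton_listed {A : Type} (P : A -> Prop) :
  (forall x y, P x -> P y -> x = y) -> exists l, forall x, P x -> In x l.
Proof.
  intros P_unique; destruct (classic (exists x, P x)) as [[x Hx]|no_P].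
  - exists [x]; intros y Hy; left; auto.
  - exists []; intros y Hy; apply no_P; eauto.
Qed.

Lemma through_fixpoints_finite a b s t f : a < s < b -> t <> s ->
  exists F, forall z, a < z < b -> through a b s t f z = z -> In z F.
Proof.
  intros Hs Ht.
  destruct (subsingleton_listed (fun z => line a (f a) s t z = z)) as [F HF].
  { intros x y; apply line_fixpoint_unique; [lra|auto]. }
  destruct (subsingleton_listed (fun z => line s t b (f b) z = z)) as [G HG].
  { intros x y; apply line_fixpoint_unique; [lra|auto]. }
  exists (F ++ G); intros z Hz fix_z; apply in_or_app.
  destruct (Rle_or_lt z s); [left; apply HF|right; apply HG];
    rewrite <- fix_z at 2; [rewrite through_left|rewrite through_right]; auto; lra.
Qed.

Lemma finite_fixpoints f p q : order_auto f -> p < q ->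
  exists f' F, order_auto f' /\ agree_outside p q f f' /\
    (forall z, p < z < q -> f' z = z -> In z F).
Proof.
  intros Hf Hpq; set (s := (p + q) / 2).
  assert (Hs : p < s < q) by (unfold s; lra).
  assert (f p < f q) by (apply order_auto_lt; auto).
  assert (exists t, f p < t < f q /\ t <> s) as (t & Ht & t_ne).
  { destruct (Req_dec ((f p + f q) / 2) s).
    - exists ((2 * f p + f q) / 3); lra.
    - exists ((f p + f q) / 2); lra. }
  destruct (through_fixpoints_finite p q s t f Hs t_ne) as [F HF].
  exists (through p q s t f), F; auto using order_auto_through, through_off.
Qed.

Lemma finite_fixpoints_list l : forall f p q, order_auto f -> p < q ->
  (forall a, In a l -> p < a < q -> f a <> a) ->
  exists f' F, order_auto f' /\ agree_outside p q f f' /\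
    (forall a, In a l -> f' a = f a) /\ (forall z, p < z < q -> f' z = z -> In z F).
Proof.
  induction l as [|a l IH]; intros f p q Hf Hpq no_fix.
  - destruct (finite_fixpoints f p q) as (h & F & Hh & h_off & h_fix); auto.
    exists h, F; split; [|split; [|split]]; auto; intros b [].
  - assert (no_fix_l : forall b, In b l -> p < b < q -> f b <> b)
      by (intros; apply no_fix; [right|]; auto).
    destruct (classic (p < a < q)) as [Ha|Ha].
    + destruct (IH f p a) as (k & F & Hk & k_off & k_l & k_fix); auto; try lra.
      { intros b Hb Hpa; apply no_fix_l; auto; lra. }
      assert (ka : k a = f a) by (apply k_off; lra).
      destruct (IH k a q) as (h & G & Hh & h_off & h_l & h_fix); auto; try lra.
      { intros b Hb Haq; rewrite k_l; auto; apply no_fix_l; auto; lra. }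
      assert (ha : h a = f a) by (rewrite h_off; auto; lra).
      exists h, (F ++ G); split; [|split; [|split]]; auto.
      * intros z Hz; rewrite h_off, k_off; auto; lra.
      * intros b [<-|Hb]; auto; rewrite h_l; auto.
      * intros z Hz fix_z; apply in_or_app; destruct (Rtotal_order z a) as [za|[->|za]].
        -- left; apply k_fix; [lra|rewrite <- h_off; auto; lra].
        -- destruct (no_fix a); auto using in_eq; congruence.
        -- right; apply h_fix; auto; lra.
    + destruct (IH f p q) as (h & F & Hh & h_off & h_l & h_fix); auto.
      exists h, F; split; [|split; [|split]]; auto; intros b [<-|Hb]; auto.
Qed.

Definition no_common_fixpoint (g : homeo_pair) : Prop :=
  forall z, 0 < z < 1 -> exists i, generator g i z <> z.

Definition standard_pair (g : homeo_pair) : Prop :=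
  no_common_fixpoint g /\
  exists e, 0 < e < 1 / 2 /\ forall i, standard_ends e (generator g i).

Lemma standard_ends_no_fixpoint e f z : standard_ends e f -> 0 < z < 1 ->
  ~ e < z < 1 - e -> f z <> z.
Proof.
  intros [f_low f_high] Hz z_end; destruct (Rle_or_lt z e);
    [rewrite f_low|rewrite f_high]; lra.
Qed.

Lemma standard_ends_ext e f f' : 0 < e < 1 / 2 -> standard_ends e f ->
  agree_outside e (1 - e) f f' -> standard_ends e f'.
Proof.
  intros He [f_low f_high] f'_off; split; intros z Hz; rewrite f'_off; auto; lra.
Qed.

(* The first generator is made piecewise linear between the ends, with finitely
   many fixed points, which the second one then avoids. *)
Lemma standard_pair_dense : dense standard_pair.
Proof.
  intros g l eps Hg eps_pos.
  destruct (at_right_0_ex (1 / 2) _ (filter_and _ _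
    (eventually_standard_ends _ l (Hg true)) (eventually_standard_ends _ l (Hg false))))
    as (e & He & (f1 & Hf1 & f1_ends & f1_l) & (f2 & Hf2 & f2_ends & f2_l)); [lra|].
  destruct (avoid_fixpoints f1 e (1 - e) l eps) with (F := l)
    as (k & Hk & k_off & k_near & k_l); auto using in_H_order_auto, incl_refl.
  destruct (finite_fixpoints_list l k e (1 - e)) as (h1 & F & Hh1 & h1_off & h1_l & h1_fix);
    auto; try lra.
  destruct (avoid_fixpoints f2 e (1 - e) (l ++ F) eps) with (F := F)
    as (h2 & Hh2 & h2_off & h2_near & h2_F); auto using in_H_order_auto, incl_appr, incl_refl.
  assert (h1_off_f1 : agree_outside e (1 - e) f1 h1)
    by (intros z Hz; rewrite h1_off; auto).
  assert (h1_ends : standard_ends e h1) by (apply (standard_ends_ext e f1); auto).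
  assert (h2_ends : standard_ends e h2) by (apply (standard_ends_ext e f2); auto).
  exists (h1, h2); split; [|split; [|split]].
  - apply Hpair_intro; [apply (in_H_agree_outside f1 h1 e (1 - e))
                       |apply (in_H_agree_outside f2 h2 e (1 - e))]; auto; lra.
  - intros i a Ha; specialize (f1_l a Ha); specialize (f2_l a Ha).
    destruct i; simpl in *; [rewrite h1_l, <- f1_l|rewrite <- f2_l]; auto using in_or_app.
  - intros z Hz; destruct (classic (e < z < 1 - e)) as [Hmid|Hend].
    + destruct (Req_dec (h1 z) z) as [fix_z|]; [|exists true; auto].
      exists false; apply h2_F; auto.
    + exists true; apply (standard_ends_no_fixpoint e); auto.
  - exists e; split; auto; intros []; auto.
Qed.

(** * Ascending runs *)

Fixpoint ascending (g : homeo_pair) (w : list letter) (x : R) : Prop :=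
  match w with
  | [] => True
  | a :: w' => x < act g a x /\ ascending g w' (act g a x)
  end.

Lemma ascending_snoc g w a x :
  ascending g w x -> run g w x < act g a (run g w x) -> ascending g (w ++ [a]) x.
Proof. revert x; induction w as [|b w IH]; simpl; [auto|intros x [Hb Hw]; auto]. Qed.

Lemma ascending_le g w x : ascending g w x -> x <= run g w x.
Proof.
  revert x; induction w as [|a w IH]; simpl; intros x; [lra|].
  intros [Ha Hw]; apply IH in Hw; lra.
Qed.

Lemma ascending_reduced g w x : Hpair g -> ascending g w x -> reduced w.
Proof.
  intros Hg; revert x; induction w as [|a w IH]; intros x; [constructor|].
  intros [Ha Hw]; constructor; [exact (IH _ Hw)|].
  destruct w as [|b w]; constructor; intros ->.
  destruct Hw as [Hb _]; rewrite act_linvK in Hb; auto; lra.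
Qed.

Lemma ascending_letter g z : Hpair g -> no_common_fixpoint g -> 0 < z < 1 ->
  exists a, z < act g a z.
Proof.
  intros Hg no_fix Hz; destruct (no_fix z Hz) as [i Hi].
  destruct (Rtotal_order z (generator g i z)) as [|[|Hlt]];
    [exists (i, true); auto|lra|].
  exists (i, false); apply (order_auto_lt_inv (act g (i, true)));
    [apply order_auto_act; auto|].
  rewrite (act_Klinv g (i, true)) by auto; exact Hlt.
Qed.

(* Otherwise the supremum of the points reached would be a common fixed point. *)
Lemma ascending_reach g x y : Hpair g -> no_common_fixpoint g -> 0 < x < 1 -> y < 1 ->
  exists u, ascending g u x /\ y < run g u x.
Proof.
  intros Hg no_fix Hx Hy; apply NNPP; intros unreached.
  set (reached := fun z => exists u, ascending g u x /\ z = run g u x).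
  assert (reached_le : forall z, reached z -> z <= y).
  { intros z (u & Hu & ->); apply Rnot_lt_le; eauto. }
  assert (reached_x : reached x) by (exists []; simpl; auto).
  destruct (completeness reached) as [s [s_ub s_least]]; [exists y; auto|eauto|].
  assert (s <= y) by (apply s_least; auto).
  pose proof (s_ub x reached_x).
  destruct (ascending_letter g s) as [a Ha]; auto; [lra|].
  assert (Hdown : act g (linv a) s < s).
  { apply (order_auto_lt_inv (act g a)); [apply order_auto_act; auto|].
    rewrite act_Klinv; auto. }
  assert (exists z, reached z /\ act g (linv a) s < z) as (z & reached_z & Hz).
  { apply NNPP; intros none; apply (Rlt_not_le _ _ Hdown), s_least.
    intros z Hz; apply Rnot_lt_le; eauto. }
  apply (order_auto_lt (act g a)) in Hz; [|apply order_auto_act; auto].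
  rewrite act_Klinv in Hz by auto.
  apply (Rlt_not_le _ _ Hz), s_ub.
  pose proof (s_ub z reached_z); destruct reached_z as (u & Hu & ->).
  exists (u ++ [a]); split; [apply ascending_snoc; auto; lra|rewrite run_app; auto].
Qed.

Definition agree_below (y : R) (g g' : homeo_pair) : Prop :=
  forall a z, z <= y -> act g a z <= y -> act g' a z = act g a z.

Lemma agree_below_trans x y g g' g'' : y <= x ->
  agree_below y g g' -> agree_below x g' g'' -> agree_below y g g''.
Proof.
  intros Hyx Hg Hg' a z Hz Haz; rewrite Hg', Hg; auto; try lra.
  rewrite Hg; auto; lra.
Qed.

Lemma agree_below_run y g g' u x : agree_below y g g' ->
  ascending g u x -> run g u x <= y -> run g' u x = run g u x.
Proof.
  intros agree; revert x; induction u as [|a u IH]; intros x; auto.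
  intros [Ha Hu] Hy; pose proof (ascending_le _ _ _ Hu); simpl in *.
  rewrite agree by lra; auto.
Qed.

Definition set_letter (g : homeo_pair) (a : letter) (f : R -> R) : homeo_pair :=
  let h := if snd a then f else hinv f in
  if fst a then (h, snd g) else (fst g, h).

Lemma Hpair_set_letter g a f : Hpair g -> in_H f -> Hpair (set_letter g a f).
Proof.
  intros Hg Hf; pose proof (Hg true : in_H (fst g)); pose proof (Hg false : in_H (snd g)).
  unfold set_letter; destruct a as [[] []]; simpl; apply Hpair_intro; auto using in_H_hinv.
Qed.

Lemma act_set_letter g a f z : order_auto f -> act (set_letter g a f) a z = f z.
Proof. destruct a as [[] []]; auto; apply hinv_hinv. Qed.

Lemma act_set_letter_other g a b f : fst b <> fst a -> act (set_letter g a f) b = act g b.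
Proof.
  intros Hab; unfold act, set_letter; destruct a as [[] s], b as [[] t]; simpl in *;
    auto; contradiction.
Qed.

Lemma agree_below_set_letter y g b f : Hpair g -> in_H f ->
  (forall z, z <= y -> act g b z <= y -> f z = act g b z) -> agree_below y g (set_letter g b f).
Proof.
  intros Hg Hf agree a z Hz Haz.
  assert (act_b : forall z, act (set_letter g b f) b z = f z)
    by (intros; apply act_set_letter, in_H_order_auto; auto).
  destruct (letter_cases a b) as [->|[->|a_b]].
  - rewrite act_b; auto.
  - apply act_linv_eq; [apply Hpair_set_letter; auto|].
    assert (act g b (act g (linv b) z) = z) as Eq by (apply act_Klinv; auto).
    rewrite act_b, agree; auto; rewrite Eq; auto.
  - rewrite act_set_letter_other; auto.
Qed.

Lemma box_corner f y : in_H f -> 0 < y < 1 ->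
  exists c, 0 < c <= y /\ f c <= y /\ forall z, z <= y -> f z <= y -> z <= c.
Proof.
  intros Hf Hy; assert (f_auto : order_auto f) by (apply in_H_order_auto; auto).
  assert (0 < hinv f y < 1) by (apply in_H_interior; auto using in_H_hinv).
  exists (Rmin y (hinv f y)); split; [|split].
  - split; [apply Rmin_pos; lra|apply Rmin_l].
  - apply Rle_trans with (f (hinv f y)); [apply order_auto_le, Rmin_r; auto|].
    rewrite hinvK; auto; lra.
  - intros z Hz fz; apply Rmin_glb; auto.
    apply (order_auto_le_inv f); auto; rewrite hinvK; auto.
Qed.

(* If [b] inverted [a], its value at [x] would be [y]; otherwise it is not
   constrained there by what must be preserved. *)
Lemma prescribe_ascent g a b y x : Hpair g -> 0 < y < x -> x < 1 ->
  act g a y = x -> b <> linv a ->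
  exists g', Hpair g' /\ agree_below y g g' /\ act g' a y = x /\ x < act g' b x < 1.
Proof.
  intros Hg Hy Hx ay b_a; set (f := act g b).
  assert (Hf : in_H f) by (apply in_H_act; auto).
  assert (f1 : f 1 = 1) by (apply in_H_outside; auto; lra).
  assert (exists c, 0 < c < x /\ f c <= x /\ (forall z, z <= y -> f z <= y -> z <= c) /\
    (a = b -> y <= c)) as (c & Hc & fc & c_ge & c_a).
  { destruct (classic (a = b)) as [<-|a_b].
    - exists y; split; [|split; [|split]]; auto; unfold f; lra.
    - destruct (box_corner f y) as (c & ? & ? & ?); auto; [lra|].
      exists c; split; [|split; [|split]]; auto; try contradiction; lra. }
  set (h := through c 1 x ((x + 1) / 2) f).
  assert (Hh : in_H h) by (apply in_H_through; auto; lra).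
  assert (h_f : forall z, z <= c -> h z = f z) by (intros; apply through_off; lra).
  assert (act_b : forall z, act (set_letter g b h) b z = h z)
    by (intros; apply act_set_letter, in_H_order_auto; auto).
  exists (set_letter g b h); split; [|split; [|split]].
  - apply Hpair_set_letter; auto.
  - apply agree_below_set_letter; auto.
  - destruct (letter_cases a b) as [->|[->|a_b]].
    + rewrite act_b, h_f; auto.
    + rewrite linvK in b_a; contradiction.
    + rewrite act_set_letter_other; auto.
  - rewrite act_b; unfold h; rewrite through_at; lra.
Qed.

Lemma ascending_extension w : forall g a y x, Hpair g -> 0 < y < x -> x < 1 ->
  act g a y = x -> reduced (a :: w) ->
  exists g', Hpair g' /\ agree_below y g g' /\ act g' a y = x /\ ascending g' w x.
Proof.
  induction w as [|b w IH]; intros g a y x Hg Hy Hx ay Hr.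
  { exists g; split; [|split; [|split]]; simpl; auto; intros d z; auto. }
  apply Sorted_inv in Hr as [Hbw Hab]; apply HdRel_inv in Hab.
  destruct (prescribe_ascent g a b y x) as (k & Hk & k_agree & k_a & k_b); auto.
  destruct (IH k b x (act k b x)) as (h & Hh & h_agree & h_b & h_w); auto; try lra.
  exists h; split; [|split; [|split]]; auto.
  - apply (agree_below_trans x y g k); auto; lra.
  - rewrite h_agree; auto; lra.
  - split; rewrite h_b; auto; lra.
Qed.

Lemma escape_above g l x y : Hpair g -> no_common_fixpoint g -> 0 < x < 1 -> y < 1 ->
  exists u a, reduced (u ++ [a]) /\ forall w, reduced (a :: w) ->
    exists g', Hpair g' /\
      (forall i z, In z l -> generator g' i z = generator g i z) /\
      y < run g' (u ++ a :: w) x.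
Proof.
  intros Hg no_fix Hx Hy.
  destruct (at_right_0_ex (1 - y) _ (filter_and _ _ (at_right_0_gap (fun z => 1 - z) l)
    (filter_and _ _ (at_right_0_gap (fun z => 1 - generator g true z) l)
      (at_right_0_gap (fun z => 1 - generator g false z) l))))
    as (d & Hd & gap & gap_true & gap_false); [lra|].
  destruct (ascending_reach g x (1 - d)) as (u & Hu & u_reach); auto; try lra.
  set (r := run g u x) in *.
  assert (Hr : 0 < r < 1) by (apply in_H_interior; auto using in_H_run).
  destruct (ascending_letter g r) as [a Ha]; auto.
  assert (0 < act g a r < 1) by (apply in_H_interior; auto using in_H_act).
  exists u, a; split; [apply (ascending_reduced g _ x), ascending_snoc; auto|].
  intros w Hw.
  destruct (ascending_extension w g a r (act g a r)) as (h & Hh & agree & h_a & h_w);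
    auto; try lra.
  exists h; split; [|split]; auto.
  - intros i z Hz; destruct (Rle_or_lt 1 z).
    + rewrite !in_H_outside; auto; lra.
    + assert (generator g i z < 1).
      { rewrite <- (in_H_outside (generator g i) 1) by (auto; lra).
        apply order_auto_lt; auto using in_H_order_auto. }
      apply (agree (i, true)); [specialize (gap z Hz); simpl in *; lra|].
      change (act g (i, true) z) with (generator g i z).
      specialize (gap_true z Hz); specialize (gap_false z Hz); destruct i; simpl in *; lra.
  - rewrite run_app, (agree_below_run r g h u x) by (auto; unfold r; lra).
    fold r; simpl; rewrite h_a; apply ascending_le in h_w; lra.
Qed.

(** * A relation satisfied by a dense set of pairs *)

Definition reduced_signs (s t : bool) (w : list letter) : Prop :=
  reduced w /\ (exists i v, w = (i, s) :: v) /\ (exists i v, w = v ++ [(i, t)]).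

Lemma reduced_signs_app r s t v w :
  reduced_signs r s v -> reduced_signs s t w -> reduced_signs r t (v ++ w).
Proof.
  intros (v_red & (i & v' & v_head) & (j & v'' & v_last))
    (w_red & (k & w' & w_head) & (m & w'' & w_last)).
  split; [|split].
  - rewrite v_last in v_red |- *; rewrite w_head in w_red |- *; apply reduced_app; auto.
    unfold linv; simpl; intros Eq; injection Eq; destruct s; discriminate.
  - exists i, (v' ++ w); rewrite v_head; reflexivity.
  - exists m, (v ++ w''); rewrite w_last, app_assoc; reflexivity.
Qed.

Lemma reduced_signs_winv s t w : reduced_signs s t w -> reduced_signs (negb t) (negb s) (winv w).
Proof.
  intros (w_red & (i & v & w_head) & (j & v' & w_last)); split; [|split].
  - apply reduced_winv; auto.
  - exists j, (winv v'); rewrite w_last, winv_app; reflexivity.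
  - exists i, (winv v); rewrite w_head; reflexivity.
Qed.

Definition difference_word : list letter := [(false, true); (true, false)].

Lemma reduced_signs_difference_word : reduced_signs true false difference_word.
Proof.
  split; [|split].
  - repeat constructor; discriminate.
  - exists false, [(true, false)]; reflexivity.
  - exists true, [(false, true)]; reflexivity.
Qed.

Lemma run_difference_word g e z : Hpair g ->
  (forall i, standard_ends e (generator g i)) -> ~ e < z < 1 - e ->
  run g difference_word z = z.
Proof.
  intros Hg ends z_end.
  assert (agree : generator g true z = generator g false z).
  { destruct (ends true) as [low high], (ends false) as [low' high'].
    destruct (classic (0 < z < 1)); [|rewrite !in_H_outside; auto].
    destruct (Rle_or_lt z e); [rewrite low, low'|rewrite high, high']; auto; lra. }
  change (hinv (generator g true) (generator g false z) = z); rewrite <- agree.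
  apply Khinv, in_H_order_auto; auto.
Qed.

Lemma pushing_word g e : Hpair g -> no_common_fixpoint g -> 0 < e < 1 / 2 ->
  (forall i, standard_ends e (generator g i)) ->
  exists u, reduced_signs false true u /\ 1 - e < run g u e.
Proof.
  intros Hg no_fix He ends.
  destruct (ascending_reach g e (1 - e)) as (u & Hu & u_reach); auto; try lra.
  set (r := run g u e) in *.
  assert (Hr : 0 < r < 1) by (apply in_H_interior; [apply in_H_run; auto|lra]).
  assert (up : r < act g (true, true) r).
  { change (r < generator g true r); rewrite (proj2 (ends true)); lra. }
  exists (u ++ [(true, true)]); split; [split; [|split]|].
  - apply (ascending_reduced g _ e), ascending_snoc; auto.
  - destruct u as [|[i s] u]; [unfold r in u_reach; simpl in u_reach; lra|].
    exists i, (u ++ [(true, true)]); destruct s; auto.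
    destruct Hu as [down _]; change (e < generator g i e) in down.
    rewrite (proj1 (ends i)) in down; lra.
  - eauto.
  - rewrite run_app; fold r; simpl; lra.
Qed.

(* The generators agree near the endpoints, so the difference word is supported
   in [(e, 1 - e)]; conjugating it by a word that pushes [e] above [1 - e] makes
   its support disjoint from the original one. *)
Lemma standard_pair_relation g : Hpair g -> standard_pair g ->
  exists w, w <> [] /\ reduced w /\ forall x, run g w x = x.
Proof.
  intros Hg (no_fix & e & He & ends).
  destruct (pushing_word g e) as (u & u_signs & u_push); auto.
  set (v := winv u ++ difference_word ++ u).
  exists (difference_word ++ v ++ winv difference_word ++ winv v).
  split; [discriminate|split].
  - pose proof reduced_signs_difference_word as d_signs.
    pose proof (reduced_signs_winv _ _ _ d_signs) as d'_signs.
    pose proof (reduced_signs_winv _ _ _ u_signs) as u'_signs.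
    simpl negb in *; refine (proj1 (_ : reduced_signs true true _)).
    unfold v; rewrite !winv_app, winvK, <- !app_assoc.
    repeat (eapply reduced_signs_app; [eassumption|]); eassumption.
  - apply run_commutator; auto.
    apply disjoint_supports_commute; try (apply order_auto_inj, order_auto_run; auto).
    intros x; destruct (Rle_or_lt x (1 - e)).
    + right; unfold v; rewrite !run_app.
      assert (run g (winv u) x < e).
      { apply (order_auto_lt_inv (run g u)); [apply order_auto_run; auto|].
        rewrite run_Kwinv; auto; lra. }
      rewrite (run_difference_word g e) by (auto; lra); apply run_Kwinv; auto.
    + left; apply (run_difference_word g e); auto; lra.
Qed.

(** * A countable base at the identity *)

Definition grid (n : nat) : list R := map (fun k => INR k / INR (S n)) (seq 0 (n + 2)).

Definition small (n : nat) : HSet := basic (fun x => x) (grid n) (/ INR (S n)).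

Lemma mesh_pos n : 0 < / INR (S n).
Proof. apply Rinv_0_lt_compat, lt_0_INR; lia. Qed.

Lemma grid_I01 n a : In a (grid n) -> I01 a.
Proof.
  intros Ha; apply in_map_iff in Ha as (k & <- & Hk); apply in_seq in Hk.
  pose proof (mesh_pos n); assert (INR k <= INR (S n)) by (apply le_INR; lia).
  pose proof (pos_INR k); pose proof (lt_0_INR (S n) ltac:(lia)).
  split; [apply Rmult_le_pos; lra|].
  apply Rle_div_l; lra.
Qed.

Lemma grid_bracket n x : 0 <= x < 1 -> exists a b, In a (grid n) /\ In b (grid n) /\
  a <= x <= b /\ b = a + / INR (S n).
Proof.
  intros Hx; pose proof (lt_0_INR (S n) ltac:(lia)) as Sn_pos.
  destruct (nfloor_ex (x * INR (S n))) as [k Hk]; [apply Rmult_le_pos; lra|].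
  assert (k < S n)%nat.
  { apply INR_lt, Rle_lt_trans with (x * INR (S n)); [lra|].
    rewrite <- (Rmult_1_l (INR (S n))) at 2; apply Rmult_lt_compat_r; lra. }
  exists (INR k / INR (S n)), (INR (S k) / INR (S n)); split; [|split; [|split]].
  - apply in_map_iff; exists k; split; auto; apply in_seq; lia.
  - apply in_map_iff; exists (S k); split; auto; apply in_seq; lia.
  - rewrite (S_INR k); split; [apply Rle_div_l|apply Rle_div_r]; lra.
  - rewrite (S_INR k); field; lra.
Qed.

Lemma small_uniform n h x : small n h -> Rabs (h x - x) < 2 * / INR (S n).
Proof.
  intros [Hh h_grid]; pose proof (mesh_pos n).
  destruct (classic (0 < x < 1)) as [Hx|Hx].
  - destruct (grid_bracket n x) as (a & b & Ha & Hb & Hab & mesh); [lra|].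
    apply h_grid in Ha, Hb; apply Rabs_def2 in Ha, Hb.
    assert (h a <= h x <= h b)
      by (split; apply order_auto_le; auto using in_H_order_auto; lra).
    apply Rabs_def1; lra.
  - rewrite (in_H_outside h), Rminus_diag, Rabs_R0; auto; lra.
Qed.

Lemma nbhs_id_small P : nbhs (fun x => x) P -> exists n, forall h, small n h -> P h.
Proof.
  intros (l & eps & [_ eps_pos] & HP).
  destruct (archimed_cor1 (eps / 2)) as (N & HN & N_pos); [lra|].
  exists (pred N); intros h Hh; apply HP; split; [apply Hh|intros a _].
  pose proof (small_uniform _ h a Hh) as Ha.
  replace (S (pred N)) with N in Ha by lia; lra.
Qed.

Lemma nbhs_id_conjugate u l eps : in_H u -> 0 < eps ->
  nbhs (fun x => x) (fun h => basic (fun x => x) l eps (fun x => hinv u (h (u x)))).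
Proof.
  intros Hu eps_pos; pose proof (in_H_order_auto u Hu).
  assert (Hl : nbhs (fun x => x)
    (fun h => forall a, In a l -> Rabs (hinv u (h (u a)) - a) < eps)).
  { apply (filter_forall_In (nbhs (fun x => x))); intros a _.
    assert (Hlt : u a < u (a + eps)) by (apply order_auto_lt; auto; lra).
    assert (Hgt : u (a - eps) < u a) by (apply order_auto_lt; auto; lra).
    generalize (filter_and _ _ (nbhs_lt _ _ _ in_H_id Hlt) (nbhs_gt _ _ _ in_H_id Hgt)).
    apply filter_imp; intros h [h_lt h_gt]; apply Rabs_def1.
    - assert (hinv u (h (u a)) < a + eps); [|lra].
      apply (order_auto_lt_inv u); auto; rewrite hinvK; auto.
    - assert (a - eps < hinv u (h (u a))); [|lra].
      apply (order_auto_lt_inv u); auto; rewrite hinvK; auto. }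
  generalize (filter_and _ _ (nbhs_in_H (fun x => x)) Hl).
  apply filter_imp; intros h [Hh h_near]; split; auto.
  apply (in_H_comp (hinv u)); [|apply in_H_comp]; auto using in_H_hinv.
Qed.

Lemma small_conjugates g (us : list (list letter)) n : Hpair g ->
  exists m, forall u w, In u us -> small m (run g w) -> small n (run g (u ++ w ++ winv u)).
Proof.
  intros Hg.
  destruct (nbhs_id_small (fun h => forall u, In u us ->
    small n (fun x => hinv (run g u) (h (run g u x))))) as [m Hm].
  { apply (filter_forall_In (nbhs (fun x => x))); intros u _.
    apply nbhs_id_conjugate; auto using in_H_run, mesh_pos. }
  exists m; intros u w Hu Hw; specialize (Hm _ Hw u Hu).
  replace (run g (u ++ w ++ winv u)) with (fun x => hinv (run g u) (run g w (run g u x)));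
    auto.
  extensionality x; rewrite !run_app.
  rewrite <- (run_Kwinv g u (run g w (run g u x))) at 1 by auto.
  apply Khinv, order_auto_run; auto.
Qed.

(** * Topological similarity *)

Lemma gen_act g a : Hpair g -> gen (fst g) (snd g) (act g a).
Proof.
  intros Hg; destruct a as [i s].
  assert (gen_i : gen (fst g) (snd g) (generator g i)) by (destruct i; constructor).
  destruct s; [exact gen_i|].
  apply (gen_inv _ _ (generator g i)); auto; intros; [apply Khinv|apply hinvK];
    apply in_H_order_auto; auto.
Qed.

Lemma gen_run g w : Hpair g -> gen (fst g) (snd g) (run g w).
Proof.
  intros Hg; induction w as [|a w IH]; [apply gen_id|].
  exact (gen_comp _ _ _ _ IH (gen_act g a Hg)).
Qed.

Section TopologicalSimilarity.

Variables (g f : homeo_pair) (phi : (R -> R) -> R -> R).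
Hypotheses (Hg : Hpair g) (Hf : Hpair f).

Let G := gen (fst g) (snd g).
Let F := gen (fst f) (snd f).

Hypothesis phi_gen : forall x, G x -> F (phi x).
Hypothesis phi_comp :
  forall x y, G x -> G y -> phi (fun t => x (y t)) = (fun t => phi x (phi y t)).
Hypothesis phi_generator : forall i, phi (generator g i) = generator f i.

Lemma similarity_id : phi (fun x => x) = (fun x => x).
Proof.
  pose proof (phi_comp _ _ (gen_id _ _) (gen_id _ _)) as idem; simpl in idem.
  extensionality t; apply (order_auto_inj (phi (fun x => x))).
  - apply in_H_order_auto, (in_H_gen (fst f) (snd f)); [apply (Hf true)|apply (Hf false)|].
    apply phi_gen, gen_id.
  - symmetry; exact (equal_f idem t).
Qed.

Lemma similarity_act a : phi (act g a) = act f a.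
Proof.
  destruct a as [i []]; [apply phi_generator|].
  pose proof (phi_comp _ _ (gen_act g (i, true) Hg) (gen_act g (i, false) Hg)) as inverse.
  replace (fun t => act g (i, true) (act g (i, false) t)) with (fun t : R => t) in inverse
    by (extensionality t; symmetry; apply (act_Klinv g (i, true)); auto).
  rewrite similarity_id in inverse.
  change (act g (i, true)) with (generator g i) in inverse; rewrite phi_generator in inverse.
  extensionality t; apply (order_auto_inj (act f (i, true))); [apply order_auto_act; auto|].
  rewrite (act_Klinv f (i, true)) by auto; symmetry; exact (equal_f inverse t).
Qed.

Lemma similarity_run w : phi (run g w) = run f w.
Proof.
  induction w as [|a w IH]; [exact similarity_id|].
  transitivity (fun t => phi (run g w) (phi (act g a) t)).
  - exact (phi_comp _ _ (gen_run g w Hg) (gen_act g a Hg)).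
  - rewrite IH, similarity_act; reflexivity.
Qed.

End TopologicalSimilarity.

Lemma rel_open_small G S : rel_open G S -> G (fun x => x) -> S (fun x => x) ->
  exists n, forall h, G h -> small n h -> S h.
Proof.
  intros (O & [_ O_nbhs] & S_O) G_id S_id.
  destruct (nbhs_id_small O) as [n Hn]; [apply O_nbhs, S_O; auto|].
  exists n; intros h Gh Hh; apply S_O; auto.
Qed.

Lemma top_similar_open_source g f O : Hpair g -> Hpair f ->
  top_similar (fst g) (snd g) (fst f) (snd f) -> H_open O -> O (fun x => x) ->
  exists n, forall w, small n (run f w) -> O (run g w).
Proof.
  intros Hg Hf (phi & phi_gen & phi_inj & _ & phi_comp & phi_1 & phi_2 & _ & phi_open) HO O_id.
  assert (phi_run : forall w, phi (run g w) = run f w)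
    by (apply similarity_run; auto; intros []; auto).
  destruct (rel_open_small _ _ (phi_open O HO)) as [n Hn].
  - apply gen_id.
  - exists (fun x => x); repeat split; auto using gen_id; exact (phi_run []).
  - exists n; intros w Hw.
    destruct (Hn (run f w)) as (x & Gx & Ox & phi_x); auto using gen_run.
    rewrite <- phi_run in phi_x; apply phi_inj in phi_x; auto using gen_run; congruence.
Qed.

Lemma top_similar_open_target g f O : Hpair g -> Hpair f ->
  top_similar (fst g) (snd g) (fst f) (snd f) -> H_open O -> O (fun x => x) ->
  exists n, forall w, small n (run g w) -> O (run f w).
Proof.
  intros Hg Hf (phi & phi_gen & _ & _ & phi_comp & phi_1 & phi_2 & phi_cont & _) HO O_id.
  assert (phi_run : forall w, phi (run g w) = run f w)
    by (apply similarity_run; auto; intros []; auto).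
  destruct (rel_open_small _ _ (phi_cont O HO)) as [n Hn].
  - apply gen_id.
  - rewrite (phi_run [] : phi (fun x => x) = _); exact O_id.
  - exists n; intros w Hw; rewrite <- phi_run; auto using gen_run.
Qed.

(** * Meagerness *)

Definition bounded_words (f : homeo_pair) (x y : R) (n : nat) : H2Set := fun a b =>
  forall w, small n (run f w) -> run (a, b) w x <= y.

Definition discrete_words (n : nat) : H2Set := fun a b =>
  forall w, w <> [] -> reduced w -> ~ small n (run (a, b) w).

Lemma reduced_conjugate u a w : reduced (u ++ [a]) -> w <> [] -> reduced w ->
  exists b, reduced ((u ++ [a; b]) ++ w ++ winv (u ++ [a; b])).
Proof.
  intros Hu w_ne Hw.
  destruct w as [|c w]; [contradiction|].
  destruct (exists_last w_ne) as (w' & d & w_last).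
  destruct (letter_avoiding (linv a) (linv c) d) as (b & b_a & b_c & b_d); exists b.
  replace (u ++ [a; b]) with ((u ++ [a]) ++ [b]) by (rewrite <- app_assoc; reflexivity).
  assert (Hub : reduced ((u ++ [a]) ++ [b])) by (apply reduced_app; auto; repeat constructor).
  apply (reduced_app (u ++ [a]) b c (w ++ _)); auto.
  - change (reduced ((c :: w) ++ winv ((u ++ [a]) ++ [b]))).
    apply reduced_winv in Hub; rewrite winv_app in *; rewrite w_last in *.
    apply (reduced_app w' d (linv b)); auto.
    intros Eq; apply b_d; rewrite <- (linvK b), Eq, linvK; reflexivity.
  - intros ->; rewrite linvK in b_c; contradiction.
Qed.

Lemma bounded_words_nowhere_dense f x y n : Hpair f -> 0 < x < 1 -> y < 1 ->
  (forall m, exists w, w <> [] /\ reduced w /\ small m (run f w)) ->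
  H2_nowhere_dense (bounded_words f x y n).
Proof.
  intros Hf Hx Hy nondiscrete; apply nowhere_dense_of_dense_avoidance; intros g l eps Hg eps_pos.
  destruct (standard_pair_dense g l eps Hg eps_pos) as (k & Hk & k_near & no_fix & _).
  destruct (escape_above k l x y) as (u & a & Hua & u_escape); auto.
  destruct (small_conjugates f
    (map (fun b => u ++ [a; b]) (list_prod [true; false] [true; false])) n Hf) as [m Hm].
  destruct (nondiscrete m) as (w & w_ne & w_red & w_small).
  destruct (reduced_conjugate u a w) as [b Hb]; auto.
  set (v := (u ++ [a; b]) ++ w ++ winv (u ++ [a; b])) in *.
  assert (v_small : small n (run f v)).
  { apply Hm; auto; apply in_map_iff; exists b; split; auto; destruct b as [[] []]; simpl; auto. }
  assert (v_eq : v = u ++ a :: b :: w ++ winv (u ++ [a; b]))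
    by (unfold v; rewrite <- app_assoc; reflexivity).
  rewrite v_eq in Hb; apply reduced_overlap in Hb as [_ Hb].
  destruct (u_escape _ Hb) as (h & Hh & h_l & h_v); rewrite <- v_eq in h_v.
  exists h; split; [|split]; auto.
  - intros i z Hz; rewrite h_l; auto.
  - generalize (nbhs2_run_gt h v x y Hh h_v); apply filter_imp.
    intros [c d] cd_v bounded; specialize (bounded v v_small); simpl in *; lra.
Qed.

Lemma discrete_words_nowhere_dense n : H2_nowhere_dense (discrete_words n).
Proof.
  apply nowhere_dense_of_dense_avoidance; intros g l eps Hg eps_pos.
  destruct (standard_pair_dense g l eps Hg eps_pos) as (k & Hk & k_near & k_standard).
  destruct (standard_pair_relation k Hk k_standard) as (w & w_ne & w_red & w_id).
  exists k; split; [|split]; auto.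
  assert (w_small : small n (run k w)).
  { replace (run k w) with (fun x : R => x) by (extensionality x; auto).
    apply basic_self; [exact in_H_id|apply mesh_pos]. }
  generalize (nbhs2_run_basic k w _ _ _ Hk w_small); apply filter_imp.
  intros [c d] cd_small discrete; exact (discrete w w_ne w_red cd_small).
Qed.

Theorem theorem3p14 : forall f1 f2 : R -> R,
  in_H f1 -> in_H f2 -> H2_meager (sim_class f1 f2).
Proof.
  intros f1 f2 Hf1 Hf2; set (f := (f1, f2)).
  assert (Hf : Hpair f) by (apply Hpair_intro; auto).
  destruct (classic (forall m, exists w, w <> [] /\ reduced w /\ small m (run f w)))
    as [nondiscrete|discrete].
  - exists (bounded_words f (1 / 2) (3 / 4)); split.
    { intros n; apply bounded_words_nowhere_dense; auto; lra. }
    intros a b (Ha & Hb & similar).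
    destruct (top_similar_open_source (a, b) f (basic (fun x => x) [1 / 2] (1 / 4)))
      as [n Hn]; auto using Hpair_intro.
    + apply H_open_basic; intros z [<-|[]]; unfold I01; lra.
    + apply basic_self; [exact in_H_id|lra].
    + exists n; intros w Hw; destruct (Hn w Hw) as [_ near_half].
      specialize (near_half _ (in_eq _ _)); apply Rabs_def2 in near_half; lra.
  - exists discrete_words; split; [exact discrete_words_nowhere_dense|].
    apply not_all_ex_not in discrete as [m discrete].
    intros a b (Ha & Hb & similar).
    destruct (top_similar_open_target (a, b) f (small m)) as [n Hn]; auto using Hpair_intro.
    + apply H_open_basic, grid_I01.
    + apply basic_self; [exact in_H_id|apply mesh_pos].
    + exists n; intros w w_ne w_red w_small; apply discrete; eauto.
Qed.
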